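(* Let $n\ge 2$, let $\lambda_1,\lambda_2,A,B>0$ be real constants with $\lambda_1A-\lambda_2B>0$, let $p_1,\dots,p_M\in\mathbb{Z}^n$ ($M\ge1$) be distinct points, let $n_1,\dots,n_M>0$ be real constants, and set $h_3=4\pi\sum_{j=1}^M n_j\delta_{p_j}$. Let $g(t)=\lambda_1e^{At}(e^{At}-1)+\lambda_2e^{-Bt}(e^{-Bt}-1)$ and let $s_0<0$ be its unique negative zero. Let $\delta\in(0,-s_0)$ and suppose that $4\pi\max_j n_j\le -g(s_0+\delta)$. Then there exists a function $u:\mathbb{Z}^n\to[s_0+\delta,0]$ such that $$-\Delta u(x)+\lambda_1e^{Au(x)}\bigl(e^{Au(x)}-1\bigr)+\lambda_2e^{-Bu(x)}\bigl(e^{-Bu(x)}-1\bigr)+h_3(x)=0\qquad\text{for all }x\in\mathbb{Z}^n.$$ Moreover, there is a constant $\epsilon_0\in(0,1)$ such that $$u(x)=O\bigl(e^{-m(1-\epsilon_0)d(x)}\bigr),\qquad m=\log\Bigl(1+\frac{\lambda_1A-\lambda_2B}{2n}\Bigr).$$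
   Context: On $\mathbb{Z}^n$ write $d(x,y)=\sum_{i=1}^n|x_i-y_i|$ and $d(x)=d(x,0)$; $x\sim y$ means $d(x,y)=1$. The graph Laplacian of $u:\mathbb{Z}^n\to\mathbb{R}$ is $\Delta u(x)=\sum_{y\sim x}(u(y)-u(x))$. Here $\delta_{p}$ is the function equal to $1$ at $p$ and $0$ elsewhere. When $\lambda_1A-\lambda_2B>0$, the function $g$ has exactly two real zeros, $s_0<0$ and $0$, and $g<0$ on $(s_0,0)$. The notation $u(x)=O(e^{-ad(x)})$ means that there is a constant $C$ with $|u(x)|\le Ce^{-ad(x)}$ for all $x\in\mathbb{Z}^n$. *)

(* Defs.v *)
From HB Require Import structures.
From mathcomp Require Import all_boot all_order all_algebra.
From mathcomp Require Import all_classical all_reals all_analysis.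

From mathcomp Require Import zify.

Set Implicit Arguments.
Unset Strict Implicit.
Unset Printing Implicit Defensive.

Import Order.TTheory GRing.Theory Num.Theory.
Import numFieldNormedType.Exports.

Local Open Scope classical_set_scope.
Local Open Scope ring_scope.

Definition dist (n : nat) (x y : 'rV[int]_n) : nat :=
  (\sum_(i < n) `|(x 0 i - y 0 i)%R|)%N.

Definition neighbors (n : nat) (x : 'rV[int]_n) : set 'rV[int]_n :=
  [set y | dist x y = 1%N].

(* [\sum_(y \in S) F y] is the library's sum over the finite support of [F] in
   [S]; it defaults to 0 on infinite support, which the next lemma excludes. *)
Lemma finite_neighbors (n : nat) (x : 'rV[int]_n) : finite_set (neighbors x).
Proof.
pose f (z : {ffun 'I_n -> 'I_3}) : 'rV[int]_n :=
  \row_i (x 0 i + (z i)%:Z - 1).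
apply: (@sub_finite_set _ _ (f @` [set: {ffun 'I_n -> 'I_3}])); last first.
  exact/finite_image/finite_finset.
move=> y /= dxy.
have le1 i : (`|(x 0 i - y 0 i)%R| <= 1)%N.
  by rewrite -[X in (_ <= X)%N]dxy /dist (bigD1 i) //= leq_addr.
exists [ffun i => inord `|(y 0 i - x 0 i + 1)%R|%N] => //.
apply/rowP => i; rewrite mxE ffunE.
have := le1 i; move: (x 0 i) (y 0 i) => a b ab.
rewrite inordK; lia.
Qed.

Definition laplacian (R : realType) (n : nat) (u : 'rV[int]_n -> R)
    (x : 'rV[int]_n) : R :=
  \sum_(y \in neighbors x) (u y - u x).

Definition delta_at (R : realType) (n : nat) (p x : 'rV[int]_n) : R :=
  (x == p)%:R.

Definition h3 (R : realType) (n M : nat) (p : 'I_M -> 'rV[int]_n)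
    (w : 'I_M -> R) (x : 'rV[int]_n) : R :=
  4 * pi * \sum_(j < M) w j * delta_at R (p j) x.

Definition g (R : realType) (lam1 lam2 A B t : R) : R :=
  lam1 * expR (A * t) * (expR (A * t) - 1)
  + lam2 * expR (- B * t) * (expR (- B * t) - 1).

Definition bigO_exp (R : realType) (n : nat) (u : 'rV[int]_n -> R) (a : R) : Prop :=
  exists C : R, forall x, `|u x| <= C * expR (- a * (dist x 0)%:R).

(* Main.v *)
(* The constants [s0 + delta] and [0] are an ordered pair of sub- and
   supersolutions, so Tarski's fixed-point theorem, applied to a monotone
   reformulation of the equation, gives a solution [u] between them. Every such
   solution decays exponentially: convexity of the exponential gives
   [g t <= c * t] on [s0 + delta, 0] for some [c > 0], so [- u] is bounded and
   satisfies [c * v <= laplacian v] away from the points p_j, and the maximum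
   principle compares it with a multiple of [exp (- a d(x))] for small [a > 0].
   Since [eps0] may be taken close to 1, any positive rate below [m] suffices. *)
Require Import Defs.
From HB Require Import structures.
From mathcomp Require Import all_boot all_order all_algebra.
From mathcomp Require Import all_classical all_reals all_analysis.
From mathcomp Require Import zify ring lra.

Set Implicit Arguments.
Unset Strict Implicit.
Unset Printing Implicit Defensive.

Import Order.TTheory GRing.Theory Num.Theory.
Import numFieldNormedType.Exports.

Local Open Scope classical_set_scope.
Local Open Scope ring_scope.

(** * Fixed points of monotone operators on bounded functions *)

(** The fixed point is the pointwise supremum [u] of all [w] in [[a, b]] with [w <= T w].
    Monotonicity gives [u <= T u]; then [T u] is itself such a [w], so [T u <= u]. *)
Lemma pointwise_tarski (R : realType) (X : Type) (a b : R)
    (T : (X -> R) -> X -> R) :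
  a <= b ->
  (forall u v, (forall x, a <= u x) -> (forall x, u x <= v x) ->
    (forall x, v x <= b) -> forall x, T u x <= T v x) ->
  (forall x, a <= T (cst a) x) -> (forall x, T (cst b) x <= b) ->
  exists u, (forall x, a <= u x <= b) /\ forall x, T u x = u x.
Proof.
move=> ab Tmono Ta Tb.
pose S : set (X -> R) :=
  [set w | (forall x, a <= w x <= b) /\ forall x, w x <= T w x].
pose u x := sup [set w x | w in S].
have Sa : S (cst a) by split=> x //=; rewrite lexx ab.
have ub x : has_ubound [set w x | w in S].
  by exists b => _ [w [wab _] <-]; have /andP[] := wab x.
have uge w x : S w -> w x <= u x by move=> Sw; apply: ub_le_sup => //; exists w.
have ule x c : (forall w, S w -> w x <= c) -> u x <= c.
  by move=> H; apply: ge_sup => [|_ [w Sw <-]]; [exists a, (cst a)|exact: H].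
have uab x : a <= u x <= b.
  by rewrite (uge _ _ Sa) ule // => w [/(_ x)/andP[]].
have ua x : a <= u x by have /andP[] := uab x.
have ulb x : u x <= b by have /andP[] := uab x.
have uTu x : u x <= T u x.
  apply: ule => w Sw; have [wab wT] := Sw.
  apply: le_trans (wT x) _; apply: Tmono => // y.
    by have /andP[] := wab y.
  exact: uge.
have Tub x : T u x <= b by apply: le_trans (Tb x); exact: Tmono.
exists u; split=> // x; apply/eqP; rewrite eq_le uTu andbT.
apply: (uge (T u)); split=> y.
  by rewrite Tub andbT (le_trans (ua y)).
exact: Tmono.
Qed.

(** * The l1 distance on the lattice and its unit steps *)

Section Dist.
Variable n : nat.
Implicit Types x y z : 'rV[int]_n.

Lemma dist_triangle x y z : (dist x z <= dist x y + dist y z)%N.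
Proof.
rewrite /dist -big_split /=; apply: leq_sum => i _.
move: (x 0 i) (y 0 i) (z 0 i) => a b c; lia.
Qed.

Lemma distC x y : dist x y = dist y x.
Proof. by apply: eq_bigr => i _; move: (x 0 i) (y 0 i) => a b; lia. Qed.

Lemma dist_addr x z : dist (x + z) x = dist z 0.
Proof. by apply: eq_bigr => i _; rewrite !mxE; congr absz; ring. Qed.

Definition unit_steps : seq 'rV[int]_n :=
  finmap.enum_fset (fset_set (neighbors (0 : 'rV[int]_n))).

Lemma mem_unit_steps z : z \in unit_steps -> dist z 0 = 1%N.
Proof.
rewrite /unit_steps in_fset_set; last exact: finite_neighbors.
by rewrite inE /neighbors /= distC.
Qed.

(** Translation by [x] carries the neighbors of 0 bijectively onto those of [x], so the
    finite-support sum becomes an ordinary sum over a list independent of [x]. *)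
Lemma laplacianE (R : realType) (u : 'rV[int]_n -> R) x :
  laplacian u x = \sum_(z <- unit_steps) (u (x + z) - u x).
Proof.
rewrite /laplacian (reindex_fsbig (fun z => x + z) (neighbors 0)) /=; last first.
  split => [z|z1 z2 _ _ /addrI //|y].
    by rewrite /neighbors /= distC => z1; rewrite distC dist_addr.
  rewrite /neighbors /= => yx; exists (y - x); last by rewrite addrC subrK.
  by rewrite distC -(dist_addr x) addrC subrK distC.
by rewrite fsbig_finite //; exact: finite_neighbors.
Qed.

Lemma dist_unit_step x z : z \in unit_steps ->
  (dist x 0 <= (dist (x + z) 0).+1)%N.
Proof.
move=> /mem_unit_steps z1.
by have := dist_triangle x (x + z) 0; rewrite (distC x (x + z)) dist_addr z1 add1n.
Qed.

End Dist.

(** * The graph Laplacian: existence, maximum principle, decay *)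

Section Laplacian.
Variables (R : realType) (n : nat).
Implicit Types (u v : 'rV[int]_n -> R).

Let N : R := (size (unit_steps n))%:R.

(** Removing the diagonal term leaves a sum that is monotone in [u]. *)
Lemma laplacian_addM u x :
  laplacian u x + N * u x = \sum_(z <- unit_steps n) u (x + z).
Proof.
rewrite laplacianE sumrB big_const_seq count_predT iter_addr addr0 /N.
by rewrite mulr_natl subrK.
Qed.

Lemma laplacian_cst (c : R) (x : 'rV[int]_n) : laplacian (cst c) x = 0.
Proof. by rewrite laplacianE big1 // => z _; rewrite subrr. Qed.

Lemma laplacianB u v x :
  laplacian (fun y => u y - v y) x = laplacian u x - laplacian v x.
Proof. by rewrite !laplacianE -sumrB; apply: eq_bigr => z _; ring. Qed.

Lemma laplacianN u x : laplacian (fun y => - u y) x = - laplacian u x.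
Proof. by rewrite !laplacianE -sumrN; apply: eq_bigr => z _; ring. Qed.

(* The shift by [N + K] makes the fixed-point operator monotone. *)
Lemma constant_sub_super_solution (a b K : R) (F : 'rV[int]_n -> R -> R) :
  a <= b -> 0 < K ->
  (forall x s t, a <= s -> s <= t -> t <= b -> F x t - F x s <= K * (t - s)) ->
  (forall x, F x a <= 0) -> (forall x, 0 <= F x b) ->
  exists u, (forall x, a <= u x <= b) /\ forall x, laplacian u x = F x (u x).
Proof.
move=> ab K0 FK Fa Fb.
have NK : 0 < N + K by rewrite ltr_wpDl // ler0n.
pose T u x := u x + (laplacian u x - F x (u x)) / (N + K).
(* Here monotonicity is visible: the neighbor sum increases with [u], and [FK] makes [K * t - F x t]
   nondecreasing in [t]. *)
have TE u x : T u x =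
    (\sum_(z <- unit_steps n) u (x + z) + (K * u x - F x (u x))) / (N + K).
  by rewrite -laplacian_addM /T; field; rewrite gt_eqF.
have [u v au uv vb x|x|x|u [uab Tu]] := @pointwise_tarski R _ a b T ab.
- rewrite !TE ler_pM2r ?invr_gt0 // lerD //; first exact: ler_sum.
  by have := FK x _ _ (au x) (uv x) (vb x); lra.
- rewrite /T laplacian_cst /= lerDl divr_ge0 ?(ltW NK) //.
  by rewrite sub0r oppr_ge0.
- rewrite /T laplacian_cst /= gerDl pmulr_lle0 ?invr_gt0 //.
  by rewrite sub0r oppr_le0.
- exists u; split=> // x; apply/eqP; rewrite -subr_eq0; apply/eqP.
  have /eqP := Tu x; rewrite /T -subr_eq0 addrC addKr.
  by rewrite mulf_eq0 invr_eq0 (gt_eqF NK) orbF => /eqP.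
Qed.

(** A positive supremum [s] need not be attained, so a point with [u x > s - e] is used: there
    [laplacian u x <= N * e], while [c * u x > c * (s - e)], impossible for small [e]. *)
Lemma maximum_principle (b c : R) u : 0 < c -> (forall x, u x <= b) ->
  (forall x, 0 < u x -> c * u x <= laplacian u x) -> forall x, u x <= 0.
Proof.
move=> c0 ub cu x0; rewrite leNgt; apply/negP => ux0.
pose s := sup (range u).
have hu : has_sup (range u).
  by split; [exists (u x0), x0|exists b => _ [x _ <-]].
have us x : u x <= s by apply: sup_upper_bound => //; exists x.
have s0 : 0 < s by apply: lt_le_trans (us x0).
have N0 : 0 <= N by rewrite ler0n.
have Nc : 0 < N + c by lra.
(* Half the threshold [c * s / (N + c)]; it also gives [e <= s / 2], hence [u x > 0]. *)
pose e := c * s / (2 * (N + c)).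
have e0 : 0 < e by rewrite /e !(mulr_gt0, invr_gt0).
have eE : (N + c) * e * 2 = c * s by rewrite /e; field; rewrite gt_eqF.
have [_ [x _ <-] xs] := sup_adherent e0 hu.
rewrite -/s in xs.
have ce : c * e * 2 <= c * s by nra.
have es : 2 * e <= s by rewrite -(ler_pM2l c0); lra.
have x0' : 0 < u x by lra.
have := cu x x0'.
have : laplacian u x + N * u x <= N * s.
  rewrite laplacian_addM; apply: le_trans (_ : \sum_(z <- unit_steps n) s <= _).
    by apply: ler_sum => z _.
  by rewrite big_const_seq count_predT iter_addr addr0 /N mulr_natl.
have : N * (s - u x) <= N * e by apply: ler_wpM2l => //; lra.
have : c * (s - e) < c * u x by rewrite ltr_pM2l.
have := mulr_gt0 c0 s0.
rewrite !mulrBr; lra.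
Qed.

(** A unit step lowers the distance to 0 by at most one, so it multiplies the exponential by at most
    [expR a]. *)
Lemma laplacian_expR_dist (a : R) (x : 'rV[int]_n) : 0 <= a ->
  laplacian (fun y => expR (- a * (dist y 0)%:R)) x
    <= N * (expR a - 1) * expR (- a * (dist x 0)%:R).
Proof.
move=> a0; rewrite laplacianE.
set q := expR (- a * (dist x 0)%:R).
apply: le_trans (_ : \sum_(z <- unit_steps n) (expR a - 1) * q <= _).
  rewrite big_seq [leRHS]big_seq; apply: ler_sum => z /(dist_unit_step x) xz.
  rewrite mulrBl mul1r lerB // /q -expRD ler_expR.
  have : (dist x 0)%:R <= (dist (x + z) 0)%:R + 1 :> R.
    by rewrite natr1 ler_nat.
  by nra.
by rewrite big_const_seq count_predT iter_addr addr0 /N -mulrA mulr_natl.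
Qed.

(** The maximum principle applies to [u - C * E]. Within radius [r], the factor [expR (a * r%:R)]
    gives [C * E >= b >= u]; beyond it, [laplacian E <= c * E]. *)
Lemma exponential_decay (a b c : R) (r : nat) u :
  0 < c -> 0 <= a -> N * (expR a - 1) <= c ->
  (forall x, 0 <= u x <= b) ->
  (forall x, (r < dist x 0)%N -> c * u x <= laplacian u x) ->
  forall x, u x <= b * expR (a * r%:R) * expR (- a * (dist x 0)%:R).
Proof.
move=> c0 a0 aN ub cu x.
have b0 : 0 <= b by have /andP[h1 h2] := ub x; exact: le_trans h2.
set C := b * _.
have C0 : 0 <= C by rewrite mulr_ge0 // expR_ge0.
pose E (y : 'rV[int]_n) := expR (- a * (dist y 0)%:R).
have E0 y : 0 <= E y by rewrite expR_ge0.
rewrite -subr_le0.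
apply: (@maximum_principle b c (fun y => u y - C * E y)) => // y.
  have /andP[_ uy] := ub y.
  by rewrite lerBlDr; apply: le_trans uy _; rewrite lerDl mulr_ge0.
case: (leqP (dist y 0) r) => [yr|yr].
  rewrite subr_gt0 ltNge => /negP[]; apply: (@le_trans _ _ b).
    by have /andP[] := ub y.
  rewrite /C -mulrA -expRD ler_peMr // -[leLHS]expR0 ler_expR.
  have : (dist y 0)%:R <= r%:R :> R by rewrite ler_nat.
  by nra.
move=> _; rewrite laplacianB mulrBr lerB ?cu //.
have -> : laplacian (fun z => C * E z) y = C * laplacian E y.
  by rewrite !laplacianE mulr_sumr; apply: eq_bigr => z _; rewrite mulrBr.
rewrite mulrCA ler_wpM2l //; apply: le_trans (laplacian_expR_dist _ a0) _.
exact: ler_wpM2r.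
Qed.

End Laplacian.

(** * Convexity bounds for the nonlinearity *)

Section Nonlinearity.
Variable R : realType.
Implicit Types a b t x y : R.

Lemma expR_sub_le x y : expR x - expR y <= expR x * (x - y).
Proof.
have := expR_ge1Dx (y - x); rewrite -(ler_pM2l (expR_gt0 x)) -expRD.
by rewrite (addrC x) subrK; lra.
Qed.

(** The tangent inequalities at [t * x] towards 0 and [x], weighted by [1 - t] and [t], add up with
    cancelling slopes. *)
Lemma expR_chord t x : 0 <= t <= 1 -> expR (t * x) <= 1 + t * (expR x - 1).
Proof.
move=> /andP[t0 t1].
have := expR_sub_le (t * x) x; have := expR_sub_le (t * x) 0; rewrite expR0.
move: (expR (t * x)) (expR x) => p q h1 h2.
have : (1 - t) * (p - 1) <= (1 - t) * (p * (t * x - 0)) by apply: ler_wpM2l; lra.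
have : t * (p - q) <= t * (p * (t * x - x)) by apply: ler_wpM2l.
lra.
Qed.

Variables lam1 lam2 A B : R.
Hypotheses (lam1_gt0 : 0 < lam1) (lam2_gt0 : 0 < lam2).
Hypotheses (A_gt0 : 0 < A) (B_gt0 : 0 < B).

Local Notation g := (g lam1 lam2 A B).

Lemma g0 : g 0 = 0.
Proof. by rewrite /Defs.g !mulr0 expR0 subrr !mulr0 addr0. Qed.

(** Expanded, [g] has two decreasing terms, [- lam1 * expR (A * t)] and [lam2 * expR (- 2 * B * t)].
    The two increasing ones have slopes bounded on [[a, 0]] by the two summands of [K]. *)
Lemma g_one_sided_lipschitz a : exists2 K, 0 < K &
  forall s t, a <= s -> s <= t -> t <= 0 -> g t - g s <= K * (t - s).
Proof.
exists (lam1 * (2 * A) + lam2 * (B * expR (- B * a))).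
  by rewrite addr_gt0 // !mulr_gt0 // expR_gt0.
move=> s t as_ st t0.
have sq x : expR x * expR x = expR (2 * x) by rewrite -expRD; congr expR; ring.
have h1 : expR (2 * (A * t)) - expR (2 * (A * s)) <= 2 * A * (t - s).
  apply: le_trans (expR_sub_le _ _) _.
  have e1 : expR (2 * (A * t)) <= 1.
    by rewrite -[leRHS]expR0 ler_expR !pmulr_rle0.
  have -> : 2 * (A * t) - 2 * (A * s) = 2 * A * (t - s) by ring.
  by rewrite -[leRHS]mul1r ler_wpM2r // !mulr_ge0 ?subr_ge0 // ltW.
have h2 : expR (A * s) <= expR (A * t) by rewrite ler_expR ler_pM2l.
have h3 : expR (2 * (- B * t)) <= expR (2 * (- B * s)).
  by rewrite ler_expR ler_pM2l // ler_nM2l // oppr_lt0.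
have h4 : expR (- B * s) - expR (- B * t) <= B * expR (- B * a) * (t - s).
  apply: le_trans (expR_sub_le _ _) _.
  have -> : - B * s - - B * t = B * (t - s) by ring.
  rewrite mulrA (mulrC _ B) ler_wpM2r ?subr_ge0 // ler_pM2l // ler_expR.
  by rewrite ler_nM2l // oppr_lt0.
rewrite /Defs.g -!mulrA !mulrBr !mulr1 !sq.
have := ler_wpM2l (ltW lam1_gt0) h1; have := ler_wpM2l (ltW lam1_gt0) h2.
have := ler_wpM2l (ltW lam2_gt0) h3; have := ler_wpM2l (ltW lam2_gt0) h4.
lra.
Qed.

(* Chord bounds of [exp (A t)] and [exp (- B t)] over [s0, 0] give
     g t <= t / s0 * P * (exp (- B (t - s0)) - exp (A (t - s0))),
   where [P] is the common absolute value of the two terms of [g s0]. *)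
Lemma g_le_linear (s0 d : R) : s0 < 0 -> g s0 = 0 -> 0 < d -> d < - s0 ->
  exists2 c, 0 < c & forall t, s0 + d <= t <= 0 -> g t <= c * t.
Proof.
move=> s00 gs0 d0 ds0.
pose a := 1 - expR (A * s0); pose b := expR (- B * s0) - 1.
have a0 : 0 < a by rewrite subr_gt0 expR_lt1 pmulr_rlt0.
have b0 : 0 < b by rewrite subr_gt0 expR_gt1 nmulr_rgt0 ?oppr_lt0.
pose P := lam1 * expR (A * s0) * a.
have P0 : 0 < P by rewrite !mulr_gt0 // expR_gt0.
have PE : P = lam2 * expR (- B * s0) * b.
  by move: gs0; rewrite /Defs.g /P /a /b; lra.
(* For [t >= s0 + d] the difference of exponentials is at most [1 - (1 + A * d) = - (A * d)]. *)
exists (P * (A * d) / - s0).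
  apply: divr_gt0; rewrite ?oppr_gt0 //.
  by apply: mulr_gt0 => //; exact: mulr_gt0.
move=> t /andP[ts t0].
pose th := t / s0.
have th01 : 0 <= th <= 1.
  rewrite /th -[_ / _]mulrNN -invrN divr_ge0 ?ler_pdivrMr; lra.
have tE : t = th * s0 by rewrite /th divfK // lt_eqF.
have th0 : 0 <= th by case/andP: th01.
have hA : th * a <= 1 - expR (A * t).
  have := expR_chord (A * s0) th01; rewrite /a tE mulrCA; lra.
have hB : expR (- B * t) - 1 <= th * b.
  have := expR_chord (- B * s0) th01; rewrite /b tE mulrCA; lra.
have hgt : g t <= th * (lam2 * expR (- B * t) * b - lam1 * expR (A * t) * a).
  have := ler_wpM2l (ltW (mulr_gt0 lam1_gt0 (expR_gt0 (A * t)))) hA.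
  have := ler_wpM2l (ltW (mulr_gt0 lam2_gt0 (expR_gt0 (- B * t)))) hB.
  rewrite /Defs.g; lra.
apply: le_trans hgt _.
have -> : P * (A * d) / - s0 * t = th * (- (P * (A * d))).
  by rewrite {1}tE; field; rewrite lt_eqF.
apply: ler_wpM2l => //.
have -> : lam2 * expR (- B * t) * b = P * expR (- B * (t - s0)).
  have -> : - B * t = - B * s0 + - B * (t - s0) by ring.
  by rewrite expRD PE; ring.
have -> : lam1 * expR (A * t) * a = P * expR (A * (t - s0)).
  have -> : A * t = A * s0 + A * (t - s0) by ring.
  by rewrite expRD /P; ring.
rewrite -mulrBr -mulrN ler_pM2l //.
have e1 : expR (- B * (t - s0)) <= 1.
  by rewrite -[leRHS]expR0 ler_expR nmulr_rle0 ?oppr_lt0 //; lra.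
have := expR_ge1Dx (A * (t - s0)).
have : A * d <= A * (t - s0) by rewrite ler_pM2l //; lra.
lra.
Qed.

End Nonlinearity.

(** * Size and support of the source term *)

Section Source.
Variables (R : realType) (n M : nat) (p : 'I_M -> 'rV[int]_n) (w : 'I_M -> R).

Lemma h3_ge0 x : (forall j, 0 < w j) -> 0 <= h3 p w x.
Proof.
move=> w0; rewrite mulr_ge0 ?mulr_ge0 ?pi_ge0 //.
by apply: sumr_ge0 => j _; rewrite mulr_ge0 ?ler0n // ltW.
Qed.

(** As the points are distinct, at most one summand is nonzero at [x]; off the points the sum is 0,
    the initial value of the maximum. *)
Lemma h3_le x : injective p ->
  h3 p w x <= 4 * pi * \big[Num.max/0]_(j < M) w j.
Proof.
move=> pinj; rewrite ler_wpM2l ?mulr_ge0 ?pi_ge0 //.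
have [[j xj]|xp] := pselect (exists j, x = p j).
  rewrite (bigD1 j) //= big1 ?addr0 /delta_at => [|i ij].
    by rewrite xj eqxx mulr1; exact: le_bigmax.
  by rewrite xj (inj_eq pinj) eq_sym (negbTE ij) mulr0.
rewrite big1 ?bigmax_ge_id // => j _.
by rewrite /delta_at; case: eqP => [xj|]; rewrite ?mulr0 //; case: xp; exists j.
Qed.

Lemma h3_eq0 x : (\max_(j < M) dist (p j) 0 < dist x 0)%N -> h3 p w x = 0.
Proof.
move=> xr; rewrite /h3 big1 ?mulr0 // => j _; rewrite /delta_at.
case: eqP => [xj|]; rewrite ?mulr0 //.
by move: xr; rewrite xj ltnNge (leq_bigmax j).
Qed.

End Source.

Theorem theorem1p2 (R : realType) (n : nat) (hn : (2 <= n)%N)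
    (lam1 lam2 A B : R)
    (hlam1 : 0 < lam1) (hlam2 : 0 < lam2) (hA : 0 < A) (hB : 0 < B)
    (hAB : 0 < lam1 * A - lam2 * B)
    (M : nat) (hM : (1 <= M)%N)
    (p : 'I_M -> 'rV[int]_n) (hp : injective p)
    (w : 'I_M -> R) (hw : forall j, 0 < w j)
    (s0 : R) (hs0 : s0 < 0) (hgs0 : g lam1 lam2 A B s0 = 0)
    (delta : R) (hdelta0 : 0 < delta) (hdelta : delta < - s0)
    (hmax : 4 * pi * \big[Num.max/0]_(j < M) w j
              <= - g lam1 lam2 A B (s0 + delta)) :
  exists u : 'rV[int]_n -> R,
    [/\ forall x, s0 + delta <= u x <= 0,
        forall x,
          - laplacian u x
          + lam1 * expR (A * u x) * (expR (A * u x) - 1)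
          + lam2 * expR (- B * u x) * (expR (- B * u x) - 1)
          + h3 p w x = 0
      & exists eps0 : R, 0 < eps0 < 1 /\
          bigO_exp u
            (ln (1 + (lam1 * A - lam2 * B) / (2 * n%:R)) * (1 - eps0))].
Proof.
have [K K0 gK] := g_one_sided_lipschitz hlam1 hlam2 hA hB (s0 + delta).
have [c c0 gc] := g_le_linear hlam1 hlam2 hA hB hs0 hgs0 hdelta0 hdelta.
(* [hmax] makes [s0 + delta] a subsolution; [g 0 = 0] and [h3 >= 0] make 0 a supersolution. *)
have [||x s t ls st t0|x|x|u [uab uE]] := @constant_sub_super_solution R n
  (s0 + delta) 0 K (fun x t => g lam1 lam2 A B t + h3 p w x).
- lra.
- exact: K0.
- by have := gK _ _ ls st t0; lra.
- by have := h3_le w x hp; lra.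
- by rewrite g0 add0r h3_ge0.
exists u; split=> //; first by move=> x; rewrite uE /g; ring.
set m := ln _.
have m0 : 0 < m.
  rewrite ln_gt0 // ltrDl divr_gt0 // mulr_gt0 // ltr0n; lia.
pose N : R := (size (unit_steps n))%:R.
have N0 : 0 <= N by rewrite ler0n.
(* Any [a] with [expR a <= k] satisfies [N * (expR a - 1) <= c]; the added 1 keeps the denominator
   positive. *)
pose k := 1 + c / (N + 1).
have k1 : 1 < k by rewrite ltrDl divr_gt0 //; lra.
(* The cap [m / 2] keeps [a < m], so that [eps0 = 1 - a / m], which turns the rate into [a], is
   positive. *)
pose a := Num.min (ln k) (m / 2).
have a0 : 0 < a by rewrite lt_min ln_gt0 // divr_gt0.
have am : a <= m / 2 by rewrite ge_min lexx orbT.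
have ak : expR a <= k.
  rewrite -[leRHS]lnK ?posrE ?ler_expR ?ge_min ?lexx //; lra.
have aN : N * (expR a - 1) <= c.
  have kE : (N + 1) * (k - 1) = c by rewrite /k; field; rewrite gt_eqF //; lra.
  apply: (@le_trans _ _ (N * (k - 1))); first by apply: ler_wpM2l => //; lra.
  by rewrite -[leRHS]kE; apply: ler_wpM2r; lra.
exists (1 - a / m); split.
  rewrite subr_gt0 gtrBl ltr_pdivrMr // divr_gt0 // andbT; lra.
have -> : m * (1 - (1 - a / m)) = a by field; rewrite gt_eqF.
exists (- (s0 + delta) * expR (a * (\max_(j < M) dist (p j) 0)%:R)) => x.
have /andP[_ ux0] := uab x; rewrite ler0_norm //.
(* Beyond all the [p j] the source vanishes, so [laplacian (- u) = - g u >= c * (- u)]. *)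
apply: (@exponential_decay R n a _ c _ (fun y => - u y)) => //.
- exact: ltW.
- by move=> y; have /andP[h1 h2] := uab y; apply/andP; split; lra.
- move=> y yr; rewrite laplacianN uE h3_eq0 // addr0.
  by have := gc _ (uab y); lra.
Qed.
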